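(* Let $\mathbb{K}$ be a field and let $\Delta$ be a PR complex (over $\mathbb{K}$) on vertex set $V$, with degree type of the form $(d_p,\dots,d_i,\underbrace{1,\dots,1}_{i-1})$ for some $p\ge i\ge1$. The complex $\widetilde\Delta=\phi_i(\Delta)$ on vertex set $V\sqcup S^i_\Delta$ is a PR complex (over $\mathbb{K}$) with degree type $(d_p,\dots,d_{i+1},d_i+1,\underbrace{1,\dots,1}_{i-1})$.
   Context: The operation $\phi_i$: for a simplicial complex $\Delta$ on a finite vertex set $V$ and a positive integer $i$, let $S^i_\Delta=\{u_\sigma:\sigma\in\Delta,\ |\sigma|\ge\dim\Delta+2-i\}$ be a set of new symbols, one for each such face (here $\dim\Delta=\max_{\sigma\in\Delta}|\sigma|-1$). $\phi_i(\Delta)$ is the complex on $V\sqcup S^i_\Delta$ obtained by adding to $\Delta$ all faces $\sigma\sqcup\{u_{\tau_1},\dots,u_{\tau_r}\}$ for each sequence $\sigma\subseteq\tau_1\subsetneq\dots\subsetneq\tau_r$ of faces of $\Delta$ with $u_{\tau_1},\dots,u_{\tau_r}\in S^i_\Delta$. PR complexes: $\widetilde{H}_i$ is reduced simplicial homology with coefficients in $\mathbb{K}$ (with $\widetilde H_{-1}(\{\emptyset\})=\mathbb{K}$), and $\mathrm{link}_\Delta\sigma=\{\tau\in\Delta:\sigma\cap\tau=\emptyset,\sigma\cup\tau\in\Delta\}$ for a face $\sigma$. A simplicial complex $\Delta$ is PR (over $\mathbb{K}$) if for every $i\ge-1$ and all faces $\sigma,\tau\in\Delta$ with $\widetilde H_i(\mathrm{link}_\Delta\sigma)\ne0\ne\widetilde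 H_i(\mathrm{link}_\Delta\tau)$ we have $|\sigma|=|\tau|$. For a PR complex $\Delta$, let $p$ be the maximum index for which some face $\sigma$ has $\widetilde H_{p-1}(\mathrm{link}_\Delta\sigma)\neq0$. For each $0\le i\le p$ faces $\sigma$ with $\widetilde H_{i-1}(\mathrm{link}_\Delta\sigma)\ne0$ exist; let $s_i$ be their common size. The degree type of $\Delta$ is $(d_p,\dots,d_1)$ with $d_i=s_{i-1}-s_i$ (these are positive integers). *)

(* Defs.v *)
From HB Require Import structures.
From mathcomp Require Import all_boot all_order all_algebra.

Set Implicit Arguments.
Unset Strict Implicit.
Unset Printing Implicit Defensive.

Import GRing.Theory.
Local Open Scope ring_scope.

(* A complex on V is a set of subsets of V.  As usual, elements of V are not
   required to be faces, and the void complex is not excluded here (it is not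
   the same as the complex [set set0]). *)
Definition simplicial_complex (V : finType) (D : {set {set V}}) : Prop :=
  forall s t : {set V}, s \in D -> t \subset s -> t \in D.

Definition link (V : finType) (D : {set {set V}}) (s : {set V}) :
    {set {set V}} :=
  [set t in D | (s :&: t == set0) && (s :|: t \in D)].

(* Only meaningful when D is not void. *)
Definition cdim (V : finType) (D : {set {set V}}) : int :=
  (\max_(s in D) #|s|)%N%:Z - 1.

Section Homology.
Variables (K : fieldType) (V : finType).

(* All chains live in the free K-module on all subsets of V; faces are
   oriented by the enumeration order of V. *)
Local Notation chain := {ffun {set V} -> K^o}.

Definition face_chain (s : {set V}) : chain := [ffun t => (t == s)%:R].

Definition face_boundary (s : {set V}) : chain :=
  \sum_(v in s)
    (-1) ^+ #|[set w in s | (enum_rank w < enum_rank v)%N]|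
      *: face_chain (s :\ v).

Definition boundary_fun (c : chain) : chain :=
  \sum_(s : {set V}) (c s : K) *: face_boundary s.

Lemma boundary_fun_linear : linear boundary_fun.
Proof.
move=> a b c; rewrite /boundary_fun scaler_sumr -big_split /=.
by apply: eq_bigr => s _; rewrite !ffunE scalerDl scalerA.
Qed.
HB.instance Definition _ :=
  GRing.isLinear.Build K chain chain _ boundary_fun boundary_fun_linear.

Definition boundary : 'End(chain) := linfun boundary_fun.

(* The index k is the number of vertices of the faces involved, i.e. it is
   shifted by one with respect to dimension: degree k here is degree k - 1 in
   the usual grading, and k = 0 is the augmentation degree. *)
Definition chains (D : {set {set V}}) (k : nat) : {vspace chain} :=
  (\sum_(s in D | #|s| == k) <[face_chain s]>)%VS.

Definition cycles (D : {set {set V}}) (k : nat) : {vspace chain} :=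
  (chains D k :&: lker boundary)%VS.

Definition boundaries (D : {set {set V}}) (k : nat) : {vspace chain} :=
  (boundary @: chains D k.+1)%VS.

Lemma boundary_face (s : {set V}) : boundary (face_chain s) = face_boundary s.
Proof.
rewrite lfunE /= /boundary_fun (bigD1 s) //= ffunE eqxx scale1r.
rewrite big1 ?addr0 // => t /negPf nts.
by rewrite ffunE nts scale0r.
Qed.

Lemma boundary_face_boundary (s : {set V}) : boundary (face_boundary s) = 0.
Proof.
pose ltV (v w : V) := (enum_rank v < enum_rank w)%N.
pose sg (s : {set V}) (v : V) := #|[set w in s | ltV w v]|.
have sg_lt v w : ltV v w -> sg (s :\ w) v = sg s v.
  move=> ltvw; apply: eq_card => x; rewrite !inE.
  by case: (eqVneq x w) => //= ->; rewrite /ltV ltnNge (ltnW ltvw) andbF.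
have sg_gt v w : v \in s -> ltV v w -> sg s w = (sg (s :\ v) w).+1.
  move=> vs ltvw; rewrite /sg (cardsD1 v) inE vs ltvw add1n; congr _.+1.
  by apply: eq_card => x; rewrite !inE andbA.
pose F v w : chain :=
  (-1) ^+ sg s v *: ((-1) ^+ sg (s :\ v) w *: face_chain (s :\ v :\ w)).
have -> : boundary (face_boundary s) = \sum_(v in s) \sum_(w in s | w != v) F v w.
  rewrite linear_sum; apply: eq_bigr => v vs.
  rewrite linearZ /= boundary_face /face_boundary scaler_sumr.
  by apply: eq_bigl => w; rewrite !inE andbC.
have anti v w : v \in s -> ltV v w -> F v w = - F w v.
  move=> vs lt; rewrite /F (sg_lt v w lt) (sg_gt v w vs lt) exprS mulN1r.
  have -> : s :\ w :\ v = s :\ v :\ w by apply/setP=> x; rewrite !inE andbCA.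
  by rewrite scaleNr opprK !scalerA mulrC.
have split v : v \in s -> \sum_(w in s | w != v) F v w =
    \sum_(w in s | ltV v w) F v w + \sum_(w in s | ltV w v) F v w.
  move=> vs; rewrite (bigID (ltV v)) /=.
  congr (_ + _); apply: eq_bigl => w; rewrite -andbA; congr (_ && _);
  by rewrite -(inj_eq enum_rank_inj) -(inj_eq val_inj) /ltV /=; case: ltngtP.
rewrite (eq_bigr _ split) big_split /=.
rewrite [X in _ + X](exchange_big_dep (mem s)) /=; last first.
  by move=> ? ? _ /andP[].
apply/eqP; rewrite addr_eq0 -sumrN; apply/eqP/eq_bigr => v vs; rewrite -sumrN.
apply: eq_big => [w|w /andP[ws lt]]; first by rewrite ?vs ?andbT.
exact: anti.
Qed.

Lemma boundaries_sub (D : {set {set V}}) (k : nat) :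
  simplicial_complex D -> (boundaries D k <= cycles D k)%VS.
Proof.
move=> cD; rewrite /boundaries limg_sum; apply/subv_sumP => s /andP[sD /eqP sk].
rewrite limg_line -memvE memv_cap boundary_face memv_ker boundary_face_boundary.
rewrite eqxx andbT; apply: memv_suml => v vs; apply: memvZ.
have svD : (s :\ v \in D) && (#|s :\ v| == k).
  rewrite (cD _ _ sD) ?subD1set //=.
  by rewrite -eqSS -sk (cardsD1 v s) vs.
by rewrite memvE; apply: (sumv_sup (s :\ v)).
Qed.

(* The reduced homology group of degree k - 1.  The quotient of the cycles by
   the boundaries is represented by a linear complement of the boundaries
   inside the cycles, to which it is isomorphic. *)
Definition rhomology (D : {set {set V}}) (k : nat) : {vspace chain} :=
  (cycles D k :\: boundaries D k)%VS.

Definition PR_complex (D : {set {set V}}) : Prop :=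
  simplicial_complex D /\
  forall (k : nat) (s t : {set V}), s \in D -> t \in D ->
    rhomology (link D s) k != 0%VS -> rhomology (link D t) k != 0%VS ->
    #|s| = #|t|.

(* The list d is (d_p, ..., d_1), so that d_j is at position p - j; n j is the
   common size of the faces whose link has homology in degree j - 1. *)
Definition degree_type (D : {set {set V}}) (d : seq nat) : Prop :=
  let p := size d in
  (forall (k : nat) (s : {set V}),
     s \in D -> rhomology (link D s) k != 0%VS -> (k <= p)%N) /\
  exists n : nat -> nat,
    (forall j : nat, (j <= p)%N ->
       (exists2 s : {set V}, s \in D & rhomology (link D s) j != 0%VS) /\
       (forall s : {set V},
          s \in D -> rhomology (link D s) j != 0%VS -> #|s| = n j)) /\
    (forall j : nat, (1 <= j <= p)%N ->
       (nth 0%N d (p - j))%:Z = (n j.-1)%:Z - (n j)%:Z).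

End Homology.

Arguments rhomology K {V} D k.
Arguments PR_complex K {V} D.
Arguments degree_type K {V} D d.

Section Phi.
Variables (V : finType) (D : {set {set V}}) (i : nat).

Definition new_faces : {set {set V}} :=
  [set s in D | cdim D + 2 - i%:Z <= #|s|%:Z].

(* The symbol u_s is the element s of this type. *)
Definition new_vertex : Type := {s : {set V} | s \in new_faces}.

Definition phi_vertex : Type := (V + new_vertex)%type.

Definition flag (T : {set new_vertex}) : bool :=
  [forall a in T, forall b in T, (val a \subset val b) || (val b \subset val a)].

(* A strictly increasing sequence of faces is encoded by its set of members,
   which is totally ordered by inclusion; phiP restates membership with
   sequences.  The faces of D itself come from T = set0. *)
Definition phi : {set {set phi_vertex}} :=
  [set (inl @: s :|: inr @: T : {set phi_vertex})
     | s : {set V} in D, T : {set new_vertex} in [pred T | flag T]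
     & [forall t in T, s \subset val t]].

Lemma phiP (F : {set phi_vertex}) :
  F \in phi <->
  exists (s : {set V}) (r : seq new_vertex),
    [/\ s \in D, sorted (fun a b : new_vertex => val a \proper val b) r,
        (forall t, ohead r = Some t -> s \subset val t) &
        F = [set inl v | v in s] :|: [set inr t | t in r]].
Proof.
pose ltS := fun a b : new_vertex => val a \proper val b.
have ltS_trans : transitive ltS by move=> b a c; apply: proper_trans.
split.
- case/imset2P => s T sD; rewrite inE inE => /andP[flagT subT] ->.
  pose leS := fun a b : new_vertex => (#|val a| <= #|val b|)%N.
  have memT t : (t \in sort leS (enum T)) = (t \in T).
    by rewrite mem_sort mem_enum.
  have flagP a b : a \in T -> b \in T -> leS a b -> a != b -> ltS a b.
    move=> aT bT leab nab; rewrite /ltS properEneq.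
    have -> /= : val a != val b by rewrite val_eqE.
    move/forallP/(_ a)/implyP/(_ aT)/forallP/(_ b)/implyP/(_ bT): flagT.
    case/orP => // sba; suff /eqP-> : val b == val a by [].
    by rewrite eqEcard sba.
  exists s, (sort leS (enum T)); split => //.
  + have leS_trans : transitive leS by move=> b a c; apply: leq_trans.
    have leS_total : total leS by move=> a b; apply: leq_total.
    have := sort_sorted leS_total (enum T).
    have : uniq (sort leS (enum T)) by rewrite sort_uniq enum_uniq.
    have : {subset sort leS (enum T) <= T} by move=> t; rewrite memT.
    elim: (sort leS (enum T)) => //= a [//|b r] IHr subr.
    case/andP=> nar ur /andP[leab pbr]; apply/andP; split.
      apply: flagP => //; first by apply: subr; rewrite inE eqxx.
        by apply: subr; rewrite !inE eqxx orbT.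
      by apply: contraNneq nar => ->; rewrite inE eqxx.
    by apply: IHr => // t tr; apply: subr; rewrite inE tr orbT.
  + move=> t def_t; suff: t \in T.
      by move=> tT; move/forallP/(_ t)/implyP/(_ tT): subT.
    rewrite -memT; case: (sort leS (enum T)) def_t => //= a r [->].
    by rewrite inE eqxx.
  + by congr (_ :|: _); apply/setP => x; apply/imsetP/imsetP => -[t tT ->];
      exists t => //; move: tT; rewrite memT.
- case=> s [r [sD sorted_r sub_r ->]].
  apply/imset2P; exists s [set t in r] => //.
  + rewrite inE inE; apply/andP; split.
      apply/forall_inP => a; rewrite inE => ar.
      apply/forall_inP => b; rewrite inE => br.
      have := sorted_r; rewrite (sorted_pairwise ltS_trans) => /pairwiseP.
      move=> /(_ a) lt_nth.
      have [ia ib] : (index a r < size r)%N /\ (index b r < size r)%N.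
        by rewrite !index_mem.
      case: (ltngtP (index a r) (index b r)) => [lt|lt|eq_ab].
      * by have := lt_nth _ _ ia ib lt; rewrite !nth_index // => /proper_sub->.
      * by have := lt_nth _ _ ib ia lt; rewrite !nth_index // => /proper_sub->;
          rewrite orbT.
      * by rewrite -(nth_index a ar) eq_ab nth_index // subxx.
    apply/forall_inP => t; rewrite inE.
    case: r sorted_r sub_r => // a r; rewrite /= => par /(_ a erefl) sa.
    rewrite inE => /predU1P[-> //|tr].
    move: par; rewrite (path_sortedE ltS_trans) => /andP[/allP/(_ t tr)].
    by move=> /proper_sub /(subset_trans sa).
  + by congr (_ :|: _); apply/setP => x; apply/imsetP/imsetP => -[t tT ->];
      exists t => //; move: tT; rewrite inE.
Qed.

End Phi.

(* Main.v *)
Require Import Defs.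
From mathcomp Require Import all_boot all_order all_algebra.
From mathcomp Require Import zify.

Set Implicit Arguments.
Unset Strict Implicit.
Unset Printing Implicit Defensive.

Import Order.TTheory GRing.Theory.

(* The homology of the link of F in degree k is, up to a shift by #|F|, that of
   the quotient complex spanned by the faces containing F.  Such quotient
   complexes are compared by long exact sequences, discarding families on which
   a perfect matching by toggling vertices exists.  For a face F = s + {u_t : t
   in T} of phi D i, toggling either u_s or a vertex of min T outside s gives:
   - if T is empty and s is new (u_s exists), the star of F is acyclic;
   - if T is empty and s is not new, it has the homology of the star of s in D;
   - if T is not empty and s is not new, it is acyclic;
   - if T is not empty and s is new, it has the homology of the star of max T in
     D, shifted by one: F can first be enlarged to (min T, T), then min T removed
     from T, until T is a singleton.
   The new faces are those of size at least s_(i-1), so in homological degrees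
   below i the sizes increase by one and in the other degrees they are kept;
   this also uses s_i < s_(i-1). *)

(** * Relative homology of convex families of sets *)

Definition convex (V : finType) (A : {set {set V}}) :=
  forall s t u : {set V}, s \in A -> u \in A -> s \subset t -> t \subset u ->
  t \in A.

(** The members of [A] satisfying such a [P] span a subcomplex of the chains on [A]; the other
    members span the quotient. *)
Definition lower_in (V : finType) (A : {set {set V}}) (P : pred {set V}) :=
  forall s t : {set V}, s \in A -> t \in A -> s \subset t -> P t -> P s.

Section Relative.
Local Open Scope ring_scope.
Variables (K : fieldType) (V : finType).
Local Notation chain := {ffun {set V} -> K^o}.
Local Notation bd := (boundary K V).
Implicit Types (A D : {set {set V}}) (s t u : {set V}) (c e : chain) (k : nat).

Definition supported A k c := forall t, c t != 0 -> t \in A /\ #|t| = k.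

(* The chains on a convex family A, with the boundary truncated to A, form a
   complex (a quotient of subcomplexes).  Its homology vanishes in degree k,
   where, as in rhomology, degrees count vertices. *)
Definition acyclic A k := forall c, supported A k c ->
  {in A, forall t, bd c t = 0} ->
  exists2 e, supported A k.+1 e & {in A, forall t, bd e t = c t}.

Lemma bdE c t : bd c t = \sum_s c s * face_boundary K s t.
Proof.
rewrite lfunE /= /boundary_fun sum_ffunE; apply: eq_bigr => s _.
by rewrite !ffunE.
Qed.

Lemma face_boundary_supp s t :
  face_boundary K s t != 0 -> exists2 v, v \in s & t = s :\ v.
Proof.
rewrite /face_boundary sum_ffunE => /eqP nz.
have [/existsP[v /andP[vs /eqP ->]]|] :=
  boolP [exists v, (v \in s) && (t == s :\ v)]; first by exists v.
move=> /existsPn no; case: nz; apply: big1 => v vs.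
by rewrite !ffunE; move: (no v); rewrite vs /= => /negPf ->; rewrite scaler0.
Qed.

Lemma face_boundary_neq0 s v : v \in s -> face_boundary K s (s :\ v) != 0.
Proof.
move=> vs; rewrite /face_boundary sum_ffunE (bigD1 v) //= !ffunE eqxx.
rewrite big1 ?addr0 => [|w /andP[ws wv]].
  by rewrite [_ *: _]mulr1 signr_eq0.
rewrite !ffunE; case: eqP => [/setP/(_ w)|_]; last by rewrite scaler0.
by rewrite !inE eqxx wv ws.
Qed.

(** [face_boundary K s] is nonzero at [t] only when [s] is [t] plus one vertex, so only those
    coefficients matter. *)
Lemma bd_local c e t :
  (forall s v, v \notin t -> s = v |: t -> c s = e s) -> bd c t = bd e t.
Proof.
move=> ce; rewrite !bdE; apply: eq_bigr => s _.
have [->|/face_boundary_supp[v vs ts]] := eqVneq (face_boundary K s t) 0.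
  by rewrite !mulr0.
by rewrite (ce s v) // ts ?setD1K // !inE eqxx.
Qed.

Lemma bd0 c t : (forall s v, v \notin t -> s = v |: t -> c s = 0) -> bd c t = 0.
Proof.
move=> c0; transitivity (bd 0 t); last by rewrite linear0 ffunE.
by apply: bd_local => s v vt /(c0 _ _ vt) ->; rewrite ffunE.
Qed.

Lemma bd_supp c t : bd c t != 0 -> exists v, v \notin t /\ c (v |: t) != 0.
Proof.
move=> nz; case: (pickP [pred v | (v \notin t) && (c (v |: t) != 0)]).
  by move=> v /andP[]; exists v.
move=> no; case/eqP: nz; apply: bd0 => s v vt ->.
by move: (no v); rewrite /= vt /= => /negbT; rewrite negbK => /eqP.
Qed.

Lemma bd_single c t v : v \notin t ->
  (forall w, w \notin t -> w != v -> c (w |: t) = 0) ->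
  bd c t = c (v |: t) * face_boundary K (v |: t) t.
Proof.
move=> vt c0; rewrite bdE (bigD1 (v |: t)) //= big1 ?addr0 // => s sv.
have [->|/face_boundary_supp[w ws ts]] := eqVneq (face_boundary K s t) 0.
  by rewrite mulr0.
have es : s = w |: t by rewrite ts setD1K.
rewrite es c0 ?mul0r // ?ts ?inE ?eqxx //.
by apply: contraNneq sv => <-; rewrite es.
Qed.

Lemma bd_bd c : bd (bd c) = 0.
Proof.
rewrite [in X in boundary K V X]lfunE /= /boundary_fun linear_sum big1 // => s _.
by rewrite linearZ /= boundary_face_boundary scaler0.
Qed.

Definition restr (P : pred {set V}) c : chain := [ffun t => if P t then c t else 0].

Lemma bdD c e t : bd (c + e) t = bd c t + bd e t.
Proof. by rewrite linearD ffunE. Qed.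

Lemma bdB c e t : bd (c - e) t = bd c t - bd e t.
Proof. by rewrite linearB !ffunE. Qed.

Lemma supportedD A k c e :
  supported A k c -> supported A k e -> supported A k (c + e).
Proof.
move=> sc se t; rewrite ffunE => nz.
have [c0|/sc //] := eqVneq (c t) 0; apply: se.
by move: nz; rewrite c0 add0r.
Qed.

Lemma supportedN A k c : supported A k c -> supported A k (- c).
Proof. by move=> sc t; rewrite ffunE oppr_eq0; apply: sc. Qed.

Lemma supportedW A (B : {set {set V}}) k c :
  A \subset B -> supported A k c -> supported B k c.
Proof. by move=> /subsetP AB sc t /sc[/AB]. Qed.

Lemma supported_restr A k (P : pred {set V}) c :
  supported A k c -> supported [set t in A | P t] k (restr P c).
Proof.
by move=> sc t; rewrite ffunE inE; case: (P t); rewrite ?eqxx // => /sc[->].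
Qed.

Lemma supported_bd A k e :
  supported A k.+1 e -> supported A k (restr (mem A) (bd e)).
Proof.
move=> se t; rewrite ffunE /=; case: ifP => [tA|]; last by rewrite eqxx.
case/bd_supp=> v [vt /se[_]]; rewrite cardsU1 vt add1n => -[]; by [].
Qed.

(** A set one vertex larger than [t] at which [bd e] is nonzero lies between [t] and a member of
    [A]. By convexity, truncation therefore discards no term relevant at [t]. *)
Lemma bd_bd_restr A k e t : convex A -> supported A k e -> t \in A ->
  bd (restr (mem A) (bd e)) t = 0.
Proof.
move=> cA se tA; transitivity (bd (bd e) t); last by rewrite bd_bd ffunE.
apply: bd_local => s v vt sE; rewrite ffunE /=; case: ifP => // /negbT sA.
apply/esym/eqP; apply: contraNT sA => /bd_supp[w [ws /se[wA _]]].
by apply: cA tA wA _ _; rewrite ?sE subsetU1.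
Qed.

(** * The long exact sequence of a subcomplex and its quotient *)

Section LongExactSequence.
Variables (A : {set {set V}}) (P : pred {set V}).
Hypotheses (cA : convex A) (lowP : lower_in A P).
Let L := [set t in A | P t].
Let U := [set t in A | ~~ P t].

Let LA : L \subset A. Proof. by apply/subsetP => t; rewrite inE => /andP[]. Qed.
Let UA : U \subset A. Proof. by apply/subsetP => t; rewrite inE => /andP[]. Qed.

Let bd_on_L k c t : supported L k c -> t \in U -> bd c t = 0.
Proof.
move=> sc tU; apply: bd0 => s v vt sE; apply/eqP; apply: contraTT tU => /sc[].
rewrite !inE => /andP[sA Ps] _; apply/negP => /andP[tA].
by rewrite (lowP tA sA _ Ps) // sE subsetU1.
Qed.

Let bd_restr_U k c t : supported A k c -> t \in U ->
  bd (restr (predC P) c) t = bd c t.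
Proof.
move=> sc tU; apply: bd_local => s v vt sE; rewrite ffunE /=.
have [->|/sc[sA _]] := eqVneq (c s) 0; first by rewrite if_same.
case: ifP => // /negbFE Ps; move: tU; rewrite inE => /andP[tA].
by rewrite (lowP tA sA _ Ps) // sE subsetU1.
Qed.

Let inLU t : t \in A -> t \in L \/ t \in U.
Proof. by move=> tA; rewrite !inE tA; case: (P t); [left|right]. Qed.

Let supported_in_L k c : supported A k c -> {in U, forall t, c t = 0} ->
  supported L k c.
Proof.
move=> sc c0 t nz; have [tA tk] := sc t nz; split=> //.
by case: (inLU tA) => // /c0/eqP; rewrite (negPf nz).
Qed.

(** Exactness at the middle term: after subtracting the truncated boundary of a chain that bounds
    [c] on the quotient [U], a cycle on the subcomplex [L] remains. *)
Lemma acyclic_extension k : acyclic L k -> acyclic U k -> acyclic A k.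
Proof.
move=> exL exU c sc bc.
have [||e se be] := exU (restr (predC P) c).
- exact: supported_restr sc.
- by move=> t tU; rewrite (bd_restr_U sc tU) bc // (subsetP UA).
have seA := supportedW UA se.
have [||f sf bf] := exL (c - restr (mem A) (bd e)).
- apply: supported_in_L.
    exact: (supportedD sc (supportedN (supported_bd seA))).
  move=> t tU; have [tA nP] : t \in A /\ ~~ P t by apply/andP; rewrite inE in tU.
  by rewrite !ffunE /= tA be // ffunE /= nP subrr.
- move=> t /(subsetP LA) tA.
  by rewrite bdB bc // (bd_bd_restr cA seA) // subr0.
exists (e + f); first exact: supportedD seA (supportedW LA sf).
move=> t tA; rewrite bdD; case: (inLU tA) => tLU.
  by rewrite bf // !ffunE /= tA addrC subrK.
rewrite (bd_on_L sf tLU) addr0 be // ffunE /=.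
by move: tLU; rewrite inE => /andP[_ ->].
Qed.

(** Exactness at [L], with the connecting map coming from degree [k.+1] of [U]: a chain bounding [c]
    in [A] restricts to a cycle on [U], and a truncated boundary moves it into [L]. *)
Lemma acyclic_lower k : acyclic A k -> acyclic U k.+1 -> acyclic L k.
Proof.
move=> exA exU c sc bc; have scA := supportedW LA sc.
have [|t tA|e se be] := exA c => //.
  by case: (inLU tA) => tLU; [apply: bc | apply: (bd_on_L sc)].
have [||g sg bg] := exU (restr (predC P) e).
- exact: supported_restr se.
- move=> t tU; have tA := subsetP UA t tU; rewrite (bd_restr_U se tU) be //.
  apply/eqP; apply: contraTT tU => /sc[].
  by rewrite !inE => /andP[_ ->]; rewrite andbF.
have sgA := supportedW UA sg.
exists (e - restr (mem A) (bd g)).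
  apply: supported_in_L.
    exact: (supportedD se (supportedN (supported_bd sgA))).
  move=> t tU; have [tA nP] : t \in A /\ ~~ P t by apply/andP; rewrite inE in tU.
  by rewrite !ffunE /= tA bg // ffunE /= nP subrr.
move=> t /(subsetP LA) tA.
by rewrite bdB be // (bd_bd_restr cA sgA) // subr0.
Qed.

(** Exactness at [U]: the obstruction to lifting a cycle to [A] lies one degree lower in [L].
    Writing [k = j.+1] covers degree 0 as well, where there is no lower degree. *)
Lemma acyclic_upper k :
  acyclic A k -> (forall j, k = j.+1 -> acyclic L j) -> acyclic U k.
Proof.
move=> exA exL c sc bc; have scA := supportedW UA sc.
(* [f] corrects [c] on [L] so that [c - f] is a cycle on all of [A]. *)
suff [f sf bf] : exists2 f, supported L k f & {in L, forall t, bd f t = bd c t}.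
  have [||e se be] := exA (c - f).
  - exact: supportedD scA (supportedN (supportedW LA sf)).
  - move=> t tA; rewrite bdB; case: (inLU tA) => tLU; first by rewrite bf ?subrr.
    by rewrite bc // (bd_on_L sf) ?subrr.
  exists (restr (predC P) e); first exact: supported_restr se.
  move=> t tU; have tA := subsetP UA t tU; rewrite (bd_restr_U se tU) be // !ffunE.
  have [->|/sf[]] := eqVneq (f t) 0; first by rewrite subr0.
  by move: tU; rewrite !inE => /andP[_ /negPf ->]; rewrite andbF.
case: k exL exA sc scA bc => [|k] exL _ sc scA bc.
  exists 0; first by move=> t; rewrite ffunE eqxx.
  move=> t _; rewrite linear0 ffunE; apply/esym/eqP/negPn/negP => /bd_supp[v [vt]].
  by case/sc => _; rewrite cardsU1 vt.
have [||f sf bf] := exL k erefl (restr (mem A) (bd c)).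
- apply: supported_in_L; first exact: supported_bd.
  by move=> t tU; rewrite ffunE /= bc // if_same.
- by move=> t /(subsetP LA) tA; rewrite (bd_bd_restr cA scA).
by exists f => // t tL; rewrite bf // ffunE /= (subsetP LA).
Qed.

End LongExactSequence.

(** * Vanishing criteria *)

Lemma acyclic_empty_degree A k : {in A, forall t, #|t| != k} -> acyclic A k.
Proof.
move=> nk c sc _; exists 0; first by move=> t; rewrite ffunE eqxx.
move=> t tA; rewrite linear0 ffunE; apply/esym/eqP/negPn/negP => /sc[/nk/eqP].
by [].
Qed.

(* The pairs {t, t with v t added} form a matching along which the boundary is
   invertible: the matched face determines the bounding chain on sets
   containing v, and the remainder is a cycle on such sets, hence zero. *)
Lemma acyclic_toggle_local A (v : {set V} -> option V) k : convex A ->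
  (forall s, s \in A -> exists x, [/\ v s = Some x, x |: s \in A & s :\ x \in A]) ->
  (forall s t, s \in A -> t \in A -> s \subset t -> v s = v t) ->
  acyclic A k.
Proof.
move=> cA tog vE c sc bc.
pose e : chain := [ffun s : {set V} => if s \in A then
   if v s is Some x then if x \in s
   then c (s :\ x) / face_boundary K s (s :\ x) else 0 else 0 else 0].
have se : supported A k.+1 e.
  move=> s; rewrite ffunE; case: ifP => [sA|]; last by rewrite eqxx.
  case: (v s) => [x|]; last by rewrite eqxx.
  case: ifP => [xs|]; last by rewrite eqxx.
  rewrite mulf_eq0 negb_or => /andP[/sc[_ sk] _]; split=> //.
  by rewrite (cardsD1 x) xs sk.
have be t x : t \in A -> v t = Some x -> x \notin t -> bd e t = c t.
  move=> tA vx xt; have [y [vy]] := tog t tA.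
  move: vy; rewrite vx => -[<-] xtA _.
  rewrite (bd_single xt) => [|w wt wx].
    rewrite ffunE xtA -(vE t) ?subsetU1 // vx setU11 setU1K // divfK //.
    by rewrite -{2}(setU1K xt) face_boundary_neq0 ?setU11.
  rewrite ffunE; case: ifP => // wA; rewrite -(vE t) ?subsetU1 // vx.
  by rewrite !inE (negPf xt) eq_sym (negPf wx).
exists e => // t tA; have [x [vx _ tA']] := tog t tA.
have [xt|] := boolP (x \in t); last exact: be.
pose d := c - restr (mem A) (bd e).
suff /eqP : d t = 0 by rewrite !ffunE /= tA subr_eq0 => /eqP.
(* In this boundary only [t] itself can contribute: the other cofaces of [t :\ x] lie outside [A] or
   omit the toggled vertex [x], where [be] applies. *)
have bdd : bd d (t :\ x) = 0.
  by rewrite bdB bc // (bd_bd_restr cA se) // subr0.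
have xt' : x \notin t :\ x by rewrite !inE eqxx.
move/eqP: bdd; rewrite (bd_single xt') => [|w wt wx].
  rewrite mulf_eq0 setD1K // => /orP[/eqP //|].
  by rewrite (negPf (face_boundary_neq0 xt)).
have [wA|wA] := boolP (w |: t :\ x \in A); last first.
  rewrite !ffunE /= (negPf wA) subr0; apply/eqP; apply: contraNT wA.
  by case/sc.
have vw : v (w |: t :\ x) = Some x.
  by rewrite -(vE (t :\ x)) ?subsetU1 // (vE _ t) ?subD1set.
rewrite !ffunE /= wA (be _ x) ?subrr // !inE eq_sym (negPf wx) eqxx //.
Qed.

Lemma acyclic0 k : acyclic set0 k.
Proof. by apply: acyclic_empty_degree => t; rewrite inE. Qed.

Lemma convex_filter A (P : pred {set V}) : convex A ->
  (forall s t u, s \in A -> u \in A -> s \subset t -> t \subset u ->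
     P s -> P u -> P t) ->
  convex [set t in A | P t].
Proof.
move=> cA cP s t u; rewrite !inE => /andP[sA Ps] /andP[uA Pu] st tu.
by rewrite (cA s t u) //= (cP s t u).
Qed.

(* The sets of equal rank [rho] form the successive quotients of a filtration
   of [A], and on each of them the toggled vertex is locally constant. *)
Lemma acyclic_toggle A (v : {set V} -> option V) (rho : {set V} -> nat) k :
  convex A ->
  (forall s, s \in A -> exists x, [/\ v s = Some x,
     x |: s \in A, s :\ x \in A, rho (x |: s) = rho s & rho (s :\ x) = rho s]) ->
  (forall s t, s \in A -> t \in A -> s \subset t ->
     (rho s <= rho t)%N /\ (rho s = rho t -> v s = v t)) ->
  acyclic A k.
Proof.
move=> cA tog vE.
have exn n : acyclic [set t in A | (rho t < n)%N] k.
  elim: n => [|n IHn].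
    by apply: acyclic_empty_degree => t; rewrite inE ltn0 andbF.
  have cAn : convex [set t in A | (rho t < n.+1)%N].
    apply: convex_filter => // s t u sA uA st tu _; apply: leq_ltn_trans.
    by case: (vE t u (cA _ _ _ sA uA st tu) uA tu).
  apply: (acyclic_extension (P := fun t => rho t < n)%N) => //.
  - move=> s t; rewrite !inE => /andP[sA _] /andP[tA _] st.
    by apply: leq_ltn_trans; case: (vE s t sA tA st).
  - suff -> : [set t in [set t in A | (rho t < n.+1)%N] | (rho t < n)%N] =
              [set t in A | (rho t < n)%N] by [].
    by apply/setP => t; rewrite !inE -andbA; case: (t \in A); lia.
  - suff -> : [set t in [set t in A | (rho t < n.+1)%N] | ~~ (rho t < n)%N] =
              [set t in A | rho t == n].
      apply: (@acyclic_toggle_local _ v).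
      + apply: convex_filter => // s t u sA uA st tu /eqP es /eqP eu.
        have tA := cA _ _ _ sA uA st tu.
        by have := vE _ _ sA tA st; have := vE _ _ tA uA tu; lia.
      + move=> s; rewrite inE => /andP[sA /eqP <-].
        by have [x [vx xA xA' rx rx']] := tog s sA; exists x;
          rewrite !inE xA xA' rx rx' eqxx.
      + move=> s t; rewrite !inE => /andP[sA /eqP es] /andP[tA /eqP et] st.
        by apply: (vE s t sA tA st).2; rewrite es et.
    by apply/setP => t; rewrite !inE -andbA; case: (t \in A); lia.
suff -> : A = [set t in A | (rho t < (\max_(s in A) rho s).+1)%N] by [].
apply/setP => t; rewrite inE; case: (boolP (t \in A)) => //= tA.
by rewrite ltnS (leq_bigmax_cond (F := rho)).
Qed.

(** * Comparison with [rhomology] *)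

Lemma mem_chains D k c : reflect (supported D k c) (c \in chains K D k).
Proof.
apply: (iffP idP) => [/memv_sumP[f fD ->] t|sc].
  rewrite sum_ffunE => nz.
  have [/andP[tD /eqP //]|nt] := boolP ((t \in D) && (#|t| == k)).
  case/eqP: nz; apply: big1 => s sD; have /vlineP[a ->] := fD s sD.
  rewrite !ffunE; case: eqP => [e|_]; last by rewrite scaler0.
  by move: nt; rewrite e sD.
have -> : c = \sum_(s in D | #|s| == k) (c s : K) *: face_chain K s.
  apply/ffunP => t; rewrite sum_ffunE.
  have [/andP[tD /eqP tk]|nt] := boolP ((t \in D) && (#|t| == k)).
    rewrite (bigD1 t) ?tD ?tk ?eqxx //= !ffunE eqxx big1 ?addr0 => [|s /andP[_ st]].
      by rewrite [_ *: _]mulr1.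
    by rewrite !ffunE eq_sym (negPf st) scaler0.
  have [->|/sc[tD /eqP tk]] := eqVneq (c t) 0; last by rewrite tD tk in nt.
  rewrite big1 // => s sD; rewrite !ffunE; case: eqP => [e|_]; last first.
    by rewrite scaler0.
  by move: nt; rewrite e sD.
by apply: memv_sumr => s _; rewrite memvZ // memv_line.
Qed.

Lemma simplicial_convex D : simplicial_complex D -> convex D.
Proof. by move=> cD s t u _ uD _ /(cD _ _ uD). Qed.

Lemma bd_out D k c t : simplicial_complex D -> supported D k c -> t \notin D ->
  bd c t = 0.
Proof.
move=> cD sc; apply: contraNeq => /bd_supp[v [_ /sc[vD _]]].
by apply: cD vD _; apply: subsetU1.
Qed.

(** The boundary of a chain supported on a simplicial complex already vanishes outside it, so the
    truncation changes nothing; and the complement [rhomology] is zero exactly when all cycles are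
    boundaries. *)
Lemma acyclicP D k : simplicial_complex D ->
  acyclic D k <-> rhomology K D k = 0%VS.
Proof.
move=> cD; have -> : rhomology K D k = 0%VS <-> (cycles K D k <= boundaries K D k)%VS.
  by rewrite -diffv_eq0; split => /eqP.
split=> [ex|/subvP sub c sc bc].
  apply/subvP => c; rewrite memv_cap memv_ker => /andP[/mem_chains sc /eqP bc].
  have [|e se be] := ex c sc; first by move=> t _; rewrite bc ffunE.
  suff <- : bd e = c by rewrite memv_img //; apply/mem_chains.
  apply/ffunP => t; have [/be //|tD] := boolP (t \in D).
  rewrite (bd_out cD se) //; apply/esym/eqP; apply: contraNT tD.
  by case/sc.
have /sub /memv_imgP[e /mem_chains se ->] : c \in cycles K D k.
  rewrite memv_cap memv_ker; apply/andP; split; first exact/mem_chains.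
  apply/eqP/ffunP => t; rewrite ffunE.
  by have [/bc //|/(bd_out cD sc)] := boolP (t \in D).
by exists e.
Qed.

End Relative.

(** * Stars and links *)

(** The open star: convex when [D] is a complex, but in general not closed under subsets. *)
Definition star (V : finType) (D : {set {set V}}) (s : {set V}) :=
  [set t in D | s \subset t].

Section Stars.
Variables (K : fieldType) (V : finType).
Implicit Types (A D : {set {set V}}) (s t u : {set V}) (k : nat).

Lemma disjoint_setU1 t u v :
  [disjoint t & v |: u] = (v \notin t) && [disjoint t & u].
Proof. by rewrite !(disjoint_sym t) !disjoints_subset subUset sub1set inE. Qed.

Lemma star_convex D s : simplicial_complex D -> convex (star D s).
Proof.
move=> cD; apply: convex_filter; first exact: simplicial_convex.
by move=> x y z _ _ xy _ sx _; apply: subset_trans xy.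
Qed.

Lemma link_simplicial D s : simplicial_complex D -> simplicial_complex (link D s).
Proof.
move=> cD t u; rewrite !inE => /and3P[tD /eqP st stD] ut.
rewrite (cD _ _ tD ut) (cD _ _ stD) ?setUS // andbT /=.
by rewrite -subset0 -st setIS.
Qed.

(* A and the family obtained by removing v are the two pieces of a family closed
   under toggling v, so no explicit signed chain isomorphism is needed. *)
Lemma acyclic_remove A v k : convex A -> {in A, forall t, v \in t} ->
  acyclic K [set t : {set V} | (v \notin t) && (v |: t \in A)] k <-> acyclic K A k.+1.
Proof.
move=> cA vA; pose B := [set t : {set V} | v |: t \in A].
have cB : convex B.
  move=> s t u; rewrite !inE => sA uA st tu.
  by apply: cA sA uA _ _; apply: setUS.
have exB j : acyclic K B j.
  apply: (@acyclic_toggle_local _ _ _ (fun=> Some v)) => // s.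
  rewrite inE => sA; exists v; rewrite !inE setUA setUid.
  suff -> : v |: s :\ v = v |: s by [].
  by apply/setP => w; rewrite !inE; case: eqP.
have lowB : lower_in B (fun t => v \notin t).
  by move=> s t _ _ st; apply: contraNN; apply/subsetP.
have -> : [set t : {set V} | (v \notin t) && (v |: t \in A)] =
          [set t in B | v \notin t].
  by apply/setP => t; rewrite !inE andbC.
have -> : A = [set t in B | ~~ (v \notin t)].
  apply/setP => t; rewrite !inE negbK; apply/idP/andP => [tA|[tA vt]].
    by rewrite (setUidPr _) ?sub1set // vA.
  by move: tA; rewrite (setUidPr _) // sub1set.
split=> ex.
  by apply: (acyclic_upper cB lowB) => // j [<-].
by apply: (acyclic_lower cB lowB).
Qed.

(** The vertices of [s] are stripped from the members of the star one at a time; each removal lowers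
    the degree by one. *)
Lemma acyclic_link D s k : simplicial_complex D ->
  acyclic K (link D s) k <-> acyclic K (star D s) (k + #|s|).
Proof.
move=> cD.
(* [F] interpolates between the star of [s], at [set0], and the link of [s], at [s]. *)
pose F (w : {set V}) := [set t : {set V} | [disjoint t & w] && (w :|: t \in star D s)].
have cF w : convex (F w).
  move=> x y z; rewrite !inE => /andP[_ /andP[_ sx]] /andP[zw /andP[wzD _]] xy yz.
  rewrite (disjointWl yz zw) (cD _ _ wzD) ?setUS //=.
  by apply: subset_trans sx _; apply: setUS.
have -> : link D s = F s.
  apply/setP => t; rewrite !inE subsetUl andbT -setI_eq0 setIC.
  by case: (boolP (s :|: t \in D)) => [/cD ->|]; rewrite ?subsetUr ?andbF.
suff H (w : {set V}) j : w \subset s -> acyclic K (F w) j <-> acyclic K (star D s) (j + #|w|).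
  exact: H.
have [n] := ubnP #|w|; elim: n => // n IHn in w j *; rewrite ltnS => wn ws.
have [->|[v vw]] := set_0Vmem w.
  rewrite cards0 addn0; suff -> : F set0 = star D s by [].
  by apply/setP => t; rewrite !inE set0U -setI_eq0 setI0 eqxx.
have vw' : v \notin w :\ v by rewrite !inE eqxx.
have cw : #|w| = #|w :\ v|.+1 by rewrite (cardsD1 v) vw.
have -> : (j + #|w|)%N = (j.+1 + #|w :\ v|)%N by rewrite cw addnS.
rewrite -IHn; [|by rewrite -cw|exact: subset_trans (subsetDl _ _) ws].
have -> : F w = [set t : {set V} | (v \notin t) && (v |: t \in F (w :\ v))].
  apply/setP => t; rewrite !inE.
  have -> : w :\ v :|: (v |: t) = w :|: t by rewrite setUA [_ :|: [set v]]setUC setD1K.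
  rewrite -{1}(setD1K vw) disjoint_setU1 (disjoint_sym (v |: t)) disjoint_setU1.
  by rewrite vw' (disjoint_sym t) -andbA.
apply: acyclic_remove => // t; rewrite inE => /andP[_]; rewrite inE => /andP[_].
by move=> /subsetP/(_ v (subsetP ws v vw)); rewrite !inE eqxx.
Qed.

Lemma rhomology_link D s k : simplicial_complex D ->
  rhomology K (link D s) k != 0%VS <-> ~ acyclic K (star D s) (k + #|s|).
Proof.
move=> cD; rewrite -(acyclic_link s k cD) acyclicP; last exact: link_simplicial.
by split=> [/eqP|] // nz; apply/eqP.
Qed.

Lemma acyclic_star_small D s k : (k < #|s|)%N -> acyclic K (star D s) k.
Proof.
move=> ks; apply: acyclic_empty_degree => t; rewrite inE => /andP[_ /subset_leq_card].
by move=> st; apply: contraTneq ks => <-; rewrite -leqNgt.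
Qed.

(** In terms of links, homology in degree [j.+1] at [s] forces homology in degree [j] at some larger
    face. The vertices outside [s] are deleted one by one until only [s] is left, and each deletion
    splits off part of the star of a larger set. *)
Lemma acyclic_star_step D s j : simplicial_complex D ->
  (forall t, s \proper t -> acyclic K (star D t) (j + #|t|)) ->
  acyclic K (star D s) (j.+1 + #|s|).
Proof.
move=> cD ex.
(* F W t is the star of t after deletion of the vertices in W; deleting one
   more vertex v splits off the star of v |: t. *)
pose F (W t : {set V}) := [set u in star D t | [disjoint u & W]].
have cF W t : convex (F W t).
  apply: convex_filter; first exact: star_convex.
  by move=> x y z _ _ _ yz _; apply: disjointWl.
have lowF W t v : lower_in (F W t) (fun u => v \notin u).
  by move=> x y _ _ xy; apply: contraNN; apply/subsetP.
have FL W t v : [set u in F W t | v \notin u] = F (v |: W) t.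
  apply/setP => u; rewrite !inE -andbA; congr (_ && _).
  by rewrite disjoint_setU1 andbC.
have FU W t v : [set u in F W t | ~~ (v \notin u)] = F W (v |: t).
  apply/setP => u; rewrite !inE negbK subUset sub1set.
  by rewrite -!andbA; congr (_ && _); rewrite andbA andbC.
have F0 W t v : v \in t -> F (v |: W) t = set0.
  move=> vt; apply/setP => u; rewrite !inE; apply/negP => /andP[/andP[_ tu]].
  by rewrite disjoint_setU1 (subsetP tu).
(* Vanishing first passes from the stars of larger sets to their deletions. *)
have exF W t : s \proper t -> acyclic K (F W t) (j + #|t|).
  have [n] := ubnP #|W|; elim: n => // n IHn in W t *; rewrite ltnS => Wn st.
  have [->|[v vW]] := set_0Vmem W.
    suff -> : F set0 t = star D t by apply: ex.
    by apply/setP => u; rewrite !inE -setI_eq0 setI0 eqxx andbT.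
  rewrite -(setD1K vW); have [/F0->|vt] := boolP (v \in t); first exact: acyclic0.
  have Wn' : (#|W :\ v| < n)%N by move: Wn; rewrite (cardsD1 v W) vW.
  rewrite -FL; apply: acyclic_lower => //; first exact: IHn.
  rewrite FU -addnS.
  have -> : #|t|.+1 = #|v |: t| by rewrite cardsU1 vt.
  by apply: IHn => //; apply: proper_sub_trans (subsetU1 _ _).
(* Induction on the number of vertices not yet deleted. *)
have exFs W : acyclic K (F W s) (j.+1 + #|s|).
  have [n] := ubnP #|~: W|; elim: n => // n IHn in W *; rewrite ltnS => Wn.
  have [/subsetP Ws|] := boolP (~: W \subset s).
    apply: acyclic_empty_degree => t; rewrite !inE => /andP[/andP[_ st] tW].
    suff -> : t = s by rewrite -[X in X != _]add0n eqn_add2r.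
    apply/eqP; rewrite eqEsubset st andbT; apply/subsetP => x xt.
    by apply: Ws; rewrite inE (disjointFr tW xt).
  case/subsetPn=> v; rewrite !inE => vW vs.
  apply: (acyclic_extension (cF W s) (lowF W s v)).
    rewrite FL; apply: IHn; apply: leq_trans Wn; apply: proper_card.
    rewrite properC; apply/properP; split; first exact: subsetU1.
    by exists v; rewrite ?setU11.
  rewrite FU addSnnS.
  have -> : #|s|.+1 = #|v |: s| by rewrite cardsU1 vs.
  by apply: exF; apply: properUr; rewrite sub1set.
have -> : star D s = F set0 s; last exact: exFs.
by apply/setP => u; rewrite !inE -setI_eq0 setI0 eqxx andbT.
Qed.

End Stars.

(** * Invariance under order-preserving injections of the vertices *)

Section Transport.
Variables (K : fieldType) (V W : finType) (f : V -> W).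
Hypothesis f_inj : injective f.
Hypothesis f_mono : forall v w : V,
  (enum_rank (f v) < enum_rank (f w))%N = (enum_rank v < enum_rank w)%N.

Lemma face_boundary_imset (s t : {set V}) :
  face_boundary K (f @: s) (f @: t) = face_boundary K s t.
Proof.
rewrite /face_boundary !sum_ffunE big_imset /=; last by move=> ? ? _ _; apply: f_inj.
apply: eq_bigr => v vs; rewrite !ffunE.
have -> : f @: s :\ f v = f @: (s :\ v).
  apply/setP => w; rewrite !inE; apply/andP/imsetP => [[wv /imsetP[x xs wE]]|[x]].
    by exists x => //; rewrite !inE xs andbT; apply: contraNneq wv => <-; rewrite wE.
  by rewrite !inE => /andP[xv xs] ->; rewrite inj_eq // imset_f.
rewrite (inj_eq (imset_inj f_inj)); congr (_ ^+ _ *: _)%R.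
rewrite -(card_imset _ f_inj); apply: eq_card => w; rewrite !inE.
apply/andP/imsetP => [[/imsetP[x xs ->]]|[x]].
  by rewrite f_mono => lt; exists x => //; rewrite inE xs.
by rewrite inE => /andP[xs lt] ->; rewrite imset_f // f_mono.
Qed.

Lemma acyclic_imset (A : {set {set V}}) k :
  acyclic K [set f @: s | s : {set V} in A] k <-> acyclic K A k.
Proof.
set B := [set _ | _ in _].
pose pull (c : {ffun {set W} -> K^o}) : {ffun {set V} -> K^o} :=
  [ffun t : {set V} => c (f @: t)].
(* The test singles out the subsets of the image of [f]; every other coefficient is zero. *)
pose push (c : {ffun {set V} -> K^o}) : {ffun {set W} -> K^o} :=
  [ffun t : {set W} => if f @: (f @^-1: t) == t then c (f @^-1: t) else 0%R].
have fK (t : {set V}) : f @^-1: (f @: t) = t.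
  by apply/setP => v; rewrite inE mem_imset.
have pushK c : pull (push c) = c by apply/ffunP => t; rewrite !ffunE !fK eqxx.
have memB (t : {set V}) : f @: t \in B = (t \in A).
  by rewrite mem_imset //; apply: imset_inj.
have pull_supp c j : supported B j c -> supported A j (pull c).
  by move=> sc t; rewrite ffunE => /sc[]; rewrite memB card_imset.
have push_supp c j : supported A j c -> supported B j (push c).
  move=> sc t; rewrite ffunE; case: ifP => [/eqP tE /sc[]|]; last by rewrite eqxx.
  by rewrite -memB tE => tB <-; split=> //; rewrite -[in LHS]tE (card_imset _ f_inj).
have bd_pull c j (t : {set V}) : supported B j c ->
    boundary K V (pull c) t = boundary K W c (f @: t).
  move=> sc; rewrite !bdE [RHS](bigID (mem [set f @: s | s : {set V} in setT])) /=.
  rewrite [X in (_ + X)%R]big1 ?addr0 => [|s sB]; last first.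
    have [->|/sc[/imsetP[x _ sE]]] := eqVneq (c s) 0%R; first by rewrite mul0r.
    by rewrite sE imset_f ?inE in sB.
  rewrite big_imset /=; last by move=> ? ? _ _; apply: imset_inj.
  by apply: eq_big => [s|s _]; rewrite ?inE // ffunE face_boundary_imset.
split=> ex c sc bc.
  have [||e se be] := ex (push c); first exact: push_supp.
    move=> _ /imsetP[t tA ->]; rewrite -(bd_pull _ k) ?pushK ?bc //.
    exact: push_supp.
  exists (pull e); first exact: pull_supp.
  by move=> t tA; rewrite (bd_pull _ _ _ se) be ?memB // ffunE fK eqxx.
have [||e se be] := ex (pull c); first exact: pull_supp.
  by move=> t tA; rewrite (bd_pull _ _ _ sc) bc // memB.
exists (push e); first exact: push_supp.
move=> _ /imsetP[t tA ->]; rewrite -(bd_pull _ k.+1) ?pushK ?be ?ffunE //.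
exact: push_supp.
Qed.

End Transport.

(** The enumeration of a sum type starts with the left summand, so boundary signs agree for faces of
    [D] and their images in [phi D i]. *)
Lemma enum_rank_inl (V W : finType) (v : V) :
  enum_rank (inl v : V + W) = enum_rank v :> nat.
Proof.
have rankE (T : finType) (x : T) : enum_rank x = index x (enum T) :> nat.
  by rewrite -{2}(nth_enum_rank x x) index_uniq ?enum_uniq // -cardE ltn_ord.
rewrite !rankE !enumT [in LHS]unlock index_cat.
rewrite index_map; last by move=> ? ? [].
by rewrite mem_map ?mem_enum -?enumT ?mem_enum // => ? ? [].
Qed.

(** * Stars in phi *)

Section PhiStars.
Variables (K : fieldType) (V : finType) (D : {set {set V}}) (i : nat).
Hypothesis cD : simplicial_complex D.
Local Notation nv := (new_vertex D i).
Local Notation pv := (phi_vertex D i).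
Local Notation X := (phi D i).
Implicit Types (s : {set V}) (t : nv) (T C : {set nv}) (F G : {set pv}) (k : nat).

Definition lpart G : {set V} := [set v | inl v \in G].
Definition rpart G : {set nv} := [set t | inr t \in G].
Definition face_of s T : {set pv} := inl @: s :|: inr @: T.
Definition cap C : {set V} := \bigcap_(t in C) val t.

Lemma lpart_face s T : lpart (face_of s T) = s.
Proof.
apply/setP => v; rewrite !inE mem_imset; last by move=> ? ? [].
by case: imsetP => [[]|]; rewrite ?orbF.
Qed.

Lemma rpart_face s T : rpart (face_of s T) = T.
Proof.
apply/setP => t; rewrite !inE [_ \in inr @: _]mem_imset; last by move=> ? ? [].
by case: imsetP => [[]|].
Qed.

Lemma face_of_parts G : face_of (lpart G) (rpart G) = G.
Proof.
apply/setP => -[v|t]; rewrite inE.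
  rewrite mem_imset; last by move=> ? ? [].
  by case: imsetP => [[]|]; rewrite ?orbF inE.
rewrite [_ \in inr @: _]mem_imset; last by move=> ? ? [].
by case: imsetP => [[]|]; rewrite inE.
Qed.

Lemma face_of_sub s T G :
  (face_of s T \subset G) = (s \subset lpart G) && (T \subset rpart G).
Proof.
rewrite subUset; congr (_ && _).
  apply/subsetP/subsetP => sub x.
    by move=> xs; rewrite inE sub // imset_f.
  by case/imsetP=> v vs ->; have := sub v vs; rewrite inE.
apply/subsetP/subsetP => sub x.
  by move=> xs; rewrite inE sub // imset_f.
by case/imsetP=> v vs ->; have := sub v vs; rewrite inE.
Qed.

Lemma card_face_of s T : #|face_of s T| = (#|s| + #|T|)%N.
Proof.
rewrite cardsU !card_imset; try by move=> ? ? [].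
suff -> : (inl @: s : {set pv}) :&: inr @: T = set0 by rewrite cards0 subn0.
apply/setP => x; rewrite !inE; apply/negP => /andP[/imsetP[v _ ->]].
by case/imsetP.
Qed.

Lemma cap_sub s C : reflect {in C, forall t : nv, s \subset val t} (s \subset cap C).
Proof. exact: bigcapsP. Qed.

Lemma cap_anti C C' : C \subset C' -> cap C' \subset cap C.
Proof.
by move=> /subsetP CC'; apply/cap_sub => t /CC' tC; apply: bigcap_inf.
Qed.

Lemma mem_phi G :
  (G \in X) = [&& lpart G \in D, flag (rpart G) & lpart G \subset cap (rpart G)].
Proof.
apply/imset2P/and3P => [[s T sD]|[lD fl sub]].
  rewrite inE inE => /andP[fT /forall_inP sT] ->.
  rewrite -/(face_of s T) lpart_face rpart_face; split=> //.
  exact/cap_sub.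
exists (lpart G) (rpart G) => //; last by rewrite -/(face_of _ _) face_of_parts.
by rewrite inE inE fl; apply/forall_inP/cap_sub.
Qed.

Lemma flagP C : reflect {in C &, forall a b : nv, val a \subset val b \/ val b \subset val a}
  (flag C).
Proof.
apply: (iffP forall_inP) => [fl a b aC bC|fl a aC].
  by apply/orP; apply: (forall_inP (fl a aC)).
by apply/forall_inP => b bC; apply/orP; apply: fl.
Qed.

Lemma flagS C C' : C \subset C' -> flag C' -> flag C.
Proof.
by move=> /subsetP CC' /flagP fl; apply/flagP => a b /CC' aC /CC'; apply: fl.
Qed.

Lemma lpartS F G : F \subset G -> lpart F \subset lpart G.
Proof. by move=> /subsetP FG; apply/subsetP => v; rewrite !inE; apply: FG. Qed.

Lemma rpartS F G : F \subset G -> rpart F \subset rpart G.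
Proof. by move=> /subsetP FG; apply/subsetP => v; rewrite !inE; apply: FG. Qed.

Lemma phi_simplicial : simplicial_complex X.
Proof.
move=> G F; rewrite !mem_phi => /and3P[lD fl sub] FG.
rewrite (cD lD (lpartS FG)) (flagS (rpartS FG) fl) /=.
apply: subset_trans (lpartS FG) _; apply: subset_trans sub _.
exact: cap_anti (rpartS FG).
Qed.

(** In a flag, a member of least size is contained in all the others, so the intersection is
    attained. *)
Lemma cap_min C : flag C -> C != set0 -> exists2 t, t \in C & val t = cap C.
Proof.
move=> /flagP fl /set0Pn[t0 t0C].
case: (arg_minnP (fun t : nv => #|val t|) t0C) => t tC tmin.
exists t => //; apply/eqP; rewrite eqEsubset (bigcap_inf t) // andbT.
apply/cap_sub => u uC; case: (fl t u tC uC) => // ut.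
by have /eqP -> : val u == val t by rewrite eqEcard ut tmin.
Qed.

Lemma flag_max C : flag C -> C != set0 ->
  exists2 t, t \in C & {in C, forall u : nv, val u \subset val t}.
Proof.
move=> /flagP fl /set0Pn[t0 t0C].
case: (arg_maxnP (fun t : nv => #|val t|) t0C) => t tC tmax.
exists t => // u uC; case: (fl u t uC tC) => // tu.
by have /eqP -> : val t == val u by rewrite eqEcard tu; apply: tmax.
Qed.

Lemma new_vertexD (t : nv) : val t \in D.
Proof. by have := valP t; rewrite inE => /andP[]. Qed.

Lemma new_facesS s s' : s \in new_faces D i -> s \subset s' -> s' \in D ->
  s' \in new_faces D i.
Proof.
rewrite !inE => /andP[_ le] ss' s'D; rewrite s'D /=.
by apply: le_trans le _; rewrite lez_nat subset_leq_card.
Qed.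

(* A face of phi D i is a pair of a face of D and a flag C above it; the minimum
   of C is cap C, with the convention that cap set0 is the whole of V. *)
Definition fam s (Q : pred {set nv}) : {set {set pv}} :=
  [set G in X | (s \subset lpart G) && Q (rpart G)].

Definition convex_pred (Q : pred {set nv}) :=
  forall A B C : {set nv}, A \subset B -> B \subset C -> Q A -> Q C -> Q B.

Lemma fam_convex s Q : convex_pred Q -> convex (fam s Q).
Proof.
move=> cQ; apply: convex_filter.
  exact: simplicial_convex phi_simplicial.
move=> x y z _ _ xy yz /andP[sx Qx] /andP[_ Qz].
rewrite (subset_trans sx (lpartS xy)) /=.
exact: cQ (rpartS xy) (rpartS yz) Qx Qz.
Qed.

Lemma star_fam s T : star X (face_of s T) = fam s (fun C : {set nv} => T \subset C).
Proof. by apply/setP => G; rewrite !inE face_of_sub. Qed.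

Lemma supset_convex T : convex_pred (fun C : {set nv} => T \subset C).
Proof. by move=> A B C AB _ TA _; apply: subset_trans AB. Qed.

(* Toggles a vertex of cap (rpart G) outside s. *)
Lemma acyclic_toggle_min s Q k : convex_pred Q ->
  (forall C : {set nv}, flag C -> s \subset cap C -> Q C -> C != set0 /\ cap C != s) ->
  acyclic K (fam s Q) k.
Proof.
move=> cQ Qmin.
pose v G : option pv := omap inl [pick x in cap (rpart G) :\: s].
(* This rank grows along inclusion because [cap] shrinks, and equal rank forces equal [cap], hence
   the same toggled vertex. *)
apply: (@acyclic_toggle _ _ _ v (fun G => #|~: cap (rpart G)|)).
- exact: fam_convex.
- move=> G; rewrite inE mem_phi => /and3P[/and3P[lD fl lc] sl QG].
  have [C0 capC] := Qmin _ fl (subset_trans sl lc) QG.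
  have [t tC tE] := cap_min fl C0.
  have [x vE] : exists2 x, v G = Some (inl x) & x \in cap (rpart G) :\: s.
    rewrite /v; case: pickP => [x xC|no]; first by exists x.
    case/negP: capC; rewrite eq_sym eqEsubset (subset_trans sl lc) /=.
    by apply/subsetP => x xC; have := no x; rewrite inE xC andbT => /negbFE.
  rewrite inE => /andP[xs xC]; exists (inl x).
  have r1 : rpart (inl x |: G) = rpart G by apply/setP => u; rewrite !inE.
  have r2 : rpart (G :\ inl x) = rpart G by apply/setP => u; rewrite !inE.
  have l1 : lpart (inl x |: G) = x |: lpart G by apply/setP => u; rewrite !inE.
  have l2 : lpart (G :\ inl x) = lpart G :\ x by apply/setP => u; rewrite !inE.
  have sub1 : x |: lpart G \subset cap (rpart G) by rewrite subUset sub1set xC.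
  rewrite !inE !mem_phi !r1 !r2 !l1 !l2 fl QG; split=> //.
  (* The enlarged set stays inside the minimum [val t] of the flag, which is a face of [D]. *)
  + by rewrite sub1 (cD (new_vertexD t)) ?tE // (subset_trans sl) ?subsetU1.
  + rewrite (cD lD) ?subD1set // (subset_trans (subD1set _ _) lc) /= andbT.
    by rewrite subsetD1 sl.
- move=> F G; rewrite !inE => _ _ FG.
  have sub : ~: cap (rpart F) \subset ~: cap (rpart G).
    by rewrite setCS cap_anti // rpartS.
  split; first exact: subset_leq_card.
  move=> eqc; suff e : cap (rpart F) = cap (rpart G) by rewrite /v e.
  by apply: setC_inj; apply/eqP; rewrite eqEcard sub eqc /=.
Qed.

(* Toggles the symbol of lpart G, which is possible unless it belongs to T. *)
Lemma acyclic_toggle_new s T k : s \in new_faces D i ->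
  acyclic K [set G in fam s (fun C : {set nv} => T \subset C)
            | lpart G \notin [set val t | t in T]] k.
Proof.
move=> sS; pose v G : option pv := omap inr (insub (lpart G)).
have cF : convex (fam s (fun C : {set nv} => T \subset C)).
  by apply: fam_convex; apply: supset_convex.
apply: (@acyclic_toggle _ _ _ v (fun G => #|lpart G|)).
- apply: convex_filter => // x y z _; rewrite inE mem_phi.
  move=> /and3P[/and3P[zD _ zc] _ Tz] xy yz _ zT; apply: contraNN zT.
  case/imsetP=> t tT yE; apply/imsetP; exists t => //.
  apply/eqP; rewrite eqEsubset -{2}yE lpartS // andbT.
  by move/cap_sub: zc; apply; apply: (subsetP Tz).
- move=> G; rewrite !inE mem_phi => /andP[/and3P[/and3P[lD fl lc] sl TG] nT].
  have lS := new_facesS sS sl lD.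
  pose u : nv := Sub (lpart G) lS.
  have r1 : rpart (inr u |: G) = u |: rpart G by apply/setP => w; rewrite !inE.
  have r2 : rpart (G :\ inr u) = rpart G :\ u by apply/setP => w; rewrite !inE.
  have l1 : lpart (inr u |: G) = lpart G by apply/setP => w; rewrite !inE.
  have l2 : lpart (G :\ inr u) = lpart G by apply/setP => w; rewrite !inE.
  exists (inr u); rewrite !inE !mem_phi !r1 !r2 !l1 !l2 lD sl nT !andbT /=.
  split=> //; first by rewrite /v insubT.
  + rewrite -andbA; apply/and3P; split.
    * have lsub w : w \in rpart G -> lpart G \subset val w by move/cap_sub: lc; apply.
      apply/flagP => a b; rewrite !in_setU1 => /predU1P[->|aG] /predU1P[->|bG].
      - by left.
      - by left; rewrite SubK; apply: lsub.
      - by right; rewrite SubK; apply: lsub.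
      - by move/flagP: fl; apply.
    * apply/cap_sub => w; rewrite in_setU1 => /predU1P[->|]; first by rewrite SubK.
      by move/cap_sub: lc; apply.
    * exact: subset_trans TG (subsetU1 _ _).
  (* Deleting [u] keeps [T] inside the flag, since [lpart G] is not one of the faces of [T]. *)
  + rewrite (flagS (subD1set _ _) fl) (subset_trans lc (cap_anti (subD1set _ _))) /=.
    rewrite subsetD1 TG; apply: contraNN nT => uT.
    by apply/imsetP; exists u => //; rewrite SubK.
- move=> F G _ _ FG; split; first by rewrite subset_leq_card ?lpartS.
  move=> eqc; suff e : lpart F = lpart G by rewrite /v e.
  by apply/eqP; rewrite eqEcard lpartS //= eqc.
Qed.

(** * Homology of the stars of the faces of [phi D i] *)

Lemma acyclic_star_new s k : s \in new_faces D i ->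
  acyclic K (star X (face_of s set0)) k.
Proof.
move=> sS; rewrite star_fam.
suff -> : fam s (fun C : {set nv} => set0 \subset C) = [set G in
    fam s (fun C : {set nv} => set0 \subset C) | lpart G \notin [set val t | t : nv in set0]].
  exact: acyclic_toggle_new.
by apply/setP => G; rewrite inE imset0 in_set0 andbT.
Qed.

(** A flag containing [T] is nonempty and its minimum is a new face, hence different from [s]. *)
Lemma acyclic_star_face s T k : s \notin new_faces D i -> T != set0 ->
  acyclic K (star X (face_of s T)) k.
Proof.
move=> sS T0; rewrite star_fam; apply: acyclic_toggle_min; first exact: supset_convex.
move=> C fl _ TC; have C0 : C != set0 by apply: contraNneq T0 => C0; rewrite -subset0 -C0.
split=> //; have [t _ <-] := cap_min fl C0.
by apply: contraNneq sS => <-; apply: valP.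
Qed.

Lemma rpart0_lower s :
  lower_in (star X (face_of s set0)) (fun G => rpart G == set0).
Proof. by move=> x y _ _ /rpartS xy /eqP y0; rewrite -subset0 -y0. Qed.

(** The members without symbols are the images under [inl] of the star of [s] in [D], and [inl]
    respects the order of the vertices. *)
Lemma acyclic_rpart0 s k :
  acyclic K [set G in star X (face_of s set0) | rpart G == set0] k <->
  acyclic K (star D s) k.
Proof.
have inl_inj : injective (inl : V -> pv) by move=> ? ? [].
rewrite -(acyclic_imset K inl_inj); last by move=> v w; rewrite !enum_rank_inl.
suff -> : [set G in star X (face_of s set0) | rpart G == set0] =
  [set (inl : V -> pv) @: t | t : {set V} in star D s] by [].
have faceE (t : {set V}) : face_of t set0 = inl @: t by rewrite /face_of imset0 setU0.
apply/setP => G; rewrite !inE mem_phi face_of_sub sub0set andbT.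
apply/andP/imsetP => [[/andP[/and3P[lD _ _] sl] /eqP r0]|[t]].
  exists (lpart G); first by rewrite inE lD.
  by rewrite -faceE -r0 face_of_parts.
rewrite inE => /andP[tD st] ->; rewrite -faceE lpart_face rpart_face st tD eqxx.
split=> //; rewrite andbT /=; apply/andP; split.
  by apply/flagP => a b; rewrite inE.
by apply/cap_sub => a; rewrite inE.
Qed.

Lemma star_phi_convex F : convex (star X F).
Proof. exact: star_convex phi_simplicial. Qed.

(** The members with a nonempty flag form an acyclic quotient, because the minimum of the flag is
    new while [s] is not. *)
Lemma acyclic_star_old s k : s \notin new_faces D i ->
  acyclic K (star X (face_of s set0)) k <-> acyclic K (star D s) k.
Proof.
move=> sS; have low := @rpart0_lower s; have cA := @star_phi_convex (face_of s set0).
have exU j : acyclic K [set G in star X (face_of s set0) | ~~ (rpart G == set0)] j.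
  suff -> : [set G in star X (face_of s set0) | ~~ (rpart G == set0)] =
            fam s (fun C : {set nv} => C != set0).
    apply: acyclic_toggle_min => [A B C AB _ A0 _|C fl _ C0].
      by apply: contraNneq A0 => B0; rewrite -subset0 -B0.
    split=> //; have [t _ <-] := cap_min fl C0.
    by apply: contraNneq sS => <-; apply: valP.
  by apply/setP => G; rewrite star_fam !inE sub0set andbT -andbA.
rewrite -acyclic_rpart0; split=> ex; first exact: (acyclic_lower cA low).
exact: (acyclic_extension cA low).
Qed.

(** The degree shift is a connecting map: the whole star of [val t] in [phi D i] is acyclic and its
    members without symbols give the star in [D], so the rest, [U], carries that homology one degree
    higher. Within [U], the flags avoiding [t] have a minimum other than [val t] and contribute
    nothing. *)
Lemma acyclic_star_single t k :
  acyclic K (star X (face_of (val t) [set t])) k.+1 <-> acyclic K (star D (val t)) k.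
Proof.
have tS := valP t; have cA := @star_phi_convex (face_of (val t) set0).
have low := @rpart0_lower (val t).
pose U := [set G in star X (face_of (val t) set0) | ~~ (rpart G == set0)].
have cU : convex U.
  apply: convex_filter => // x y z _ _ /rpartS xy _ x0 _.
  by apply: contraNneq x0 => y0; rewrite -subset0 -y0.
have lowU : lower_in U (fun G => t \notin rpart G).
  by move=> x y _ _ /rpartS/subsetP xy; apply: contraNN; apply: xy.
have exN j : acyclic K [set G in U | t \notin rpart G] j.
  suff -> : [set G in U | t \notin rpart G] =
            fam (val t) (fun C : {set nv} => (C != set0) && (t \notin C)).
    apply: acyclic_toggle_min => [A B C AB /subsetP BC /andP[A0 _] /andP[_ tC]|C fl _].
      apply/andP; split; last by apply: contraNN tC; apply: BC.
      by apply: contraNneq A0 => B0; rewrite -subset0 -B0.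
    case/andP=> C0 tC; split=> //; have [u uC <-] := cap_min fl C0.
    by apply: contraNneq tC => /val_inj <-.
  by apply/setP => G; rewrite /U star_fam !inE sub0set andbT -!andbA.
have starE : star X (face_of (val t) [set t]) = [set G in U | ~~ (t \notin rpart G)].
  apply/setP => G; rewrite /U !star_fam !inE sub1set sub0set andbT negbK inE.
  case: (boolP (inr t \in G)) => tG; rewrite ?andbF // !andbT.
  suff -> : rpart G != set0 by rewrite andbT.
  by apply/set0Pn; exists t; rewrite inE.
rewrite -acyclic_rpart0 starE.
have exA j : acyclic K (star X (face_of (val t) set0)) j by apply: acyclic_star_new.
have H : acyclic K U k.+1 <-> acyclic K [set G in U | ~~ (t \notin rpart G)] k.+1.
  split=> ex; first exact: (acyclic_upper cU lowU).
  exact: (acyclic_extension cU lowU).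
rewrite -H; split=> ex; first exact: (acyclic_lower cA low).
by apply: (acyclic_upper cA low) => // j [<-].
Qed.

(** Passing from [s] to [val t] discards the members whose part in [D] is not a face of [T]; these
    are matched by toggling the symbol of that part. Any other part is a face of [T] contained in
    the minimum [val t], hence equal to it. *)
Lemma acyclic_star_min s T t k : s \in new_faces D i -> s \subset val t ->
  t \in T -> {in T, forall u : nv, val t \subset val u} ->
  acyclic K (star X (face_of s T)) k <-> acyclic K (star X (face_of (val t) T)) k.
Proof.
move=> sS st tT tmin; pose P G := lpart G \notin [set val u | u in T].
have cA := @star_phi_convex (face_of s T).
have low : lower_in (star X (face_of s T)) P.
  move=> x y _; rewrite inE mem_phi face_of_sub => /and3P[/and3P[_ _ yc] _ Ty] xy.
  apply: contraNN; case/imsetP=> u uT xE; apply/imsetP; exists u => //.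
  apply/eqP; rewrite eqEsubset -{2}xE lpartS // andbT.
  by move/cap_sub: yc; apply; apply: (subsetP Ty).
have exL j : acyclic K [set G in star X (face_of s T) | P G] j.
  by rewrite star_fam; apply: acyclic_toggle_new.
have -> : star X (face_of (val t) T) = [set G in star X (face_of s T) | ~~ P G].
  apply/setP => G; rewrite !inE negbK !face_of_sub.
  case: (boolP (G \in X)) => //=; rewrite mem_phi => /and3P[_ _ /cap_sub lc].
  case: (boolP (T \subset rpart G)) => TG; rewrite ?andbF //= !andbT.
  apply/idP/andP => [tl|[_ /imsetP[u uT ->]]]; last exact: tmin.
  split; first exact: subset_trans tl.
  apply/imsetP; exists t => //; apply/eqP; rewrite eqEsubset tl andbT.
  by apply: lc; apply: (subsetP TG).
split=> ex; first exact: (acyclic_upper cA low).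
exact: (acyclic_extension cA low).
Qed.

(** The two stars differ by flags that contain the nonempty [T :\ t] but avoid [t]; their minimum
    exists and is not [val t], so a vertex can be toggled. *)
Lemma acyclic_star_drop T t k : flag T -> t \in T -> T :\ t != set0 ->
  acyclic K (star X (face_of (val t) T)) k <->
  acyclic K (star X (face_of (val t) (T :\ t))) k.
Proof.
move=> fl tT /set0Pn[t' t'T]; have cA := @star_phi_convex (face_of (val t) (T :\ t)).
have low : lower_in (star X (face_of (val t) (T :\ t))) (fun G => t \notin rpart G).
  by move=> x y _ _ /rpartS/subsetP xy; apply: contraNN; apply: xy.
have exL j : acyclic K [set G in star X (face_of (val t) (T :\ t)) | t \notin rpart G] j.
  suff -> : [set G in star X (face_of (val t) (T :\ t)) | t \notin rpart G] =
            fam (val t) (fun C : {set nv} => (T :\ t \subset C) && (t \notin C)).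
    apply: acyclic_toggle_min => [A B C AB /subsetP BC /andP[TA _] /andP[_ tC]|C flC _].
      by rewrite (subset_trans TA AB); apply: contraNN tC; apply: BC.
    case/andP=> /subsetP TC tC.
    have C0 : C != set0 by apply/set0Pn; exists t'; apply: TC.
    split=> //; have [u uC <-] := cap_min flC C0.
    by apply: contraNneq tC => /val_inj <-.
  by apply/setP => G; rewrite star_fam !inE -!andbA.
have -> : star X (face_of (val t) T) =
    [set G in star X (face_of (val t) (T :\ t)) | ~~ (t \notin rpart G)].
  apply/setP => G; rewrite !star_fam !inE negbK -!andbA -{1}(setD1K tT).
  by rewrite subUset sub1set inE; do 2!congr (_ && _); rewrite andbC.
split=> ex; last exact: (acyclic_upper cA low).
exact: (acyclic_extension cA low).
Qed.

(** The degree stays fixed while [s] is enlarged and [T] shrinks; the shift by one occurs only when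
    a singleton is left. The maximum [t] survives each removal of the minimum. *)
Lemma acyclic_star_flag s T t k : s \in new_faces D i -> face_of s T \in X ->
  t \in T -> {in T, forall u : nv, val u \subset val t} ->
  acyclic K (star X (face_of s T)) k.+1 <-> acyclic K (star D (val t)) k.
Proof.
have [n] := ubnP #|T|; elim: n => // n IHn in s T *; rewrite ltnS => Tn sS FX tT tmax.
have := FX; rewrite mem_phi lpart_face rpart_face => /and3P[sD fl sc].
have T0 : T != set0 by apply/set0Pn; exists t.
have [a aT aE] := cap_min fl T0.
have amin : {in T, forall u : nv, val a \subset val u}.
  by move=> u uT; rewrite aE; apply: bigcap_inf.
rewrite (acyclic_star_min _ sS _ aT amin); last by rewrite aE.
have [T1|T1] := eqVneq (T :\ a) set0.
  have TE : T = [set a] by rewrite -(setD1K aT) T1 setU0.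
  have ta : t = a by apply/set1P; rewrite -TE.
  by rewrite TE ta; apply: acyclic_star_single.
rewrite acyclic_star_drop //; apply: IHn.
- by move: Tn; rewrite (cardsD1 a) aT.
- exact: valP.
- rewrite mem_phi lpart_face rpart_face new_vertexD (flagS (subD1set _ _) fl) /=.
  by rewrite aE cap_anti ?subD1set.
- rewrite !inE tT andbT; case/set0Pn: T1 => u; rewrite !inE => /andP[ua uT].
  apply: contraNneq ua => ta; apply/eqP/val_inj/eqP.
  by rewrite eqEsubset amin // -ta tmax.
- by move=> u; rewrite inE => /andP[_ uT]; apply: tmax.
Qed.

End PhiStars.

(** * Sizes of faces and the degree type *)

(** The chain of [s] alone is a cycle on its star, and no face is large enough to bound it. *)
Lemma facet_not_acyclic (K : fieldType) (V : finType) (D : {set {set V}})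
    (s : {set V}) : s \in D -> (forall t, t \in D -> (#|t| <= #|s|)%N) ->
  ~ acyclic K (star D s) #|s|.
Proof.
move=> sD smax ex; have [|t|e se be] := ex (face_chain K s).
- move=> t; rewrite ffunE; case: (t =P s) => [-> _|]; last by rewrite eqxx.
  by rewrite inE sD subxx.
- rewrite inE => /andP[_ /subset_leq_card st]; apply/eqP/negPn/negP.
  case/bd_supp=> v [vt]; rewrite ffunE; case: (v |: t =P s) => [E|]; last by rewrite eqxx.
  by move: st; rewrite -E cardsU1 vt add1n ltnn.
have e0 : e = 0%R.
  apply/ffunP => t; rewrite ffunE; apply/eqP/negPn/negP => /se[].
  by rewrite inE => /andP[/smax]; rewrite leqNgt => /negP h _ E; apply: h; rewrite E.
have := be s; rewrite inE sD subxx e0 linear0 !ffunE eqxx => /(_ isT)/eqP.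
by rewrite eq_sym oner_eq0.
Qed.

(** The old and new degree types differ only in the entry following [s1]. *)
Lemma nth_cat_cons (T : Type) (x0 x y : T) (s1 s2 : seq T) k :
  nth x0 (s1 ++ x :: s2) k = if k == size s1 then x else nth x0 (s1 ++ y :: s2) k.
Proof.
rewrite !nth_cat; case: (ltngtP k (size s1)) => // [lt|->]; last by rewrite subnn.
by case: (k - size s1)%N (subn_gt0 (size s1) k) => //; rewrite lt.
Qed.

Section DegreeType.
Variables (K : fieldType) (V : finType) (D : {set {set V}}) (p i di : nat).
Variables (ds : seq nat) (n : nat -> nat).
Hypotheses (hi : 1 <= i) (hip : i <= p) (hds : size ds = p - i).
Hypothesis cD : simplicial_complex D.
Hypothesis le_p : forall k s, s \in D -> rhomology K (link D s) k != 0%VS -> k <= p.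
Hypothesis nE : forall k s, k <= p -> s \in D ->
  rhomology K (link D s) k != 0%VS -> #|s| = n k.
Hypothesis ex_face : forall k, k <= p ->
  exists2 s, s \in D & rhomology K (link D s) k != 0%VS.
Hypothesis dE : forall j, 1 <= j <= p ->
  n j.-1 = n j + nth 0 (ds ++ di :: nseq i.-1 1) (p - j).

Lemma size_anti j k : j <= k -> k <= p -> n k <= n j.
Proof.
elim: k => [|k IHk]; first by rewrite leqn0 => /eqP ->.
rewrite leq_eqVlt => /predU1P[-> //|jk] kp.
by apply: leq_trans (IHk jk (ltnW kp)); have := dE (j := k.+1); rewrite /= kp; lia.
Qed.

(** The trailing ones of the degree type make consecutive sizes below index [i] differ by one. *)
Lemma size_low j : j < i -> n 0 = n j + j.
Proof.
elim: j => [|j IHj] ji; first by rewrite addn0.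
have := dE (j := j.+1); rewrite /= (leq_trans (ltnW ji) hip) nth_cat hds.
have -> : p - j.+1 < p - i = false by lia.
have -> : p - j.+1 - (p - i) = (i - j.+2).+1 by lia.
rewrite /= nth_nseq; have -> : i - j.+2 < i.-1 by lia.
by move/(_ isT); have := IHj (ltnW ji); lia.
Qed.

(* The degree di is not assumed positive; this follows by applying
   acyclic_star_step to a face of size n i. *)
Lemma size_gap : n i < n i.-1.
Proof.
rewrite ltn_neqAle size_anti ?leq_pred // andbT; apply/eqP => eqn.
have [s sD hs] := ex_face hip.
have /(rhomology_link K s i cD) := hs; case.
rewrite -(prednK hi); apply: acyclic_star_step => // t st.
have [tD|tD] := boolP (t \in D); last first.
  apply: acyclic_empty_degree => u; rewrite inE => /andP[uD tu].
  by rewrite (cD uD tu) in tD.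
apply/(acyclic_link K t i.-1 cD)/acyclicP; first exact: link_simplicial.
apply/eqP/negPn/negP => ht; move/proper_card: st.
rewrite (nE _ tD ht) -?eqn ?(nE hip sD hs) ?ltnn //.
by apply: leq_trans (leq_pred _) hip.
Qed.

(** The link of a face of maximal size has homology in degree 0, so the maximal size is [n 0]. The
    threshold [cdim D + 2 - i] is then [n 0 - (i - 1)], which is [n i.-1] by [size_low]. *)
Lemma mem_new_faces s : s \in D -> (s \in new_faces D i) = (n i.-1 <= #|s|).
Proof.
move=> sD; suff H : \max_(t in D) #|t| = n 0.
  rewrite inE sD /= /cdim H; have := @size_low i.-1; rewrite prednK // leqnn.
  by move=> /(_ isT) ->; lia.
have D0 : 0 < #|D| by apply/card_gt0P; exists s.
have [t tD tE] := eq_bigmax_cond (fun t : {set V} => #|t|) D0.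
rewrite tE; apply: (nE _ tD) => //; apply/(rhomology_link K t 0 cD).
apply: facet_not_acyclic => // u uD; rewrite -tE.
exact: (leq_bigmax_cond (F := fun t : {set V} => #|t|)).
Qed.

(** Only the drop from index [i - 1] to index [i] changes, and it grows by one. *)
Definition phi_size j := if j < i then (n j).+1 else n j.

Lemma phi_link_size k F : F \in phi D i -> rhomology K (link (phi D i) F) k != 0%VS ->
  k <= p /\ #|F| = phi_size k.
Proof.
move=> FX /(rhomology_link K F k (phi_simplicial cD)).
rewrite -(face_of_parts F) in FX *; move: (lpart F) (rpart F) FX => s T FX.
have := FX; rewrite mem_phi lpart_face rpart_face => /and3P[sD fl sc].
rewrite card_face_of; have [T0|T0] := eqVneq T set0.
  rewrite T0 cards0 addn0.
  have [sS|sS] := boolP (s \in new_faces D i).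
    by case; apply: acyclic_star_new.
  move=> nex; have {}nex : ~ acyclic K (star D s) (k + #|s|).
    by move=> ex; apply: nex; apply/acyclic_star_old.
  have /(rhomology_link K s k cD) hs := nex.
  have kp := le_p sD hs; split=> //; rewrite (nE kp sD hs) /phi_size.
  (* An index [k < i] would give [s] size at least [n i.-1] and make it new. *)
  case: ifP => // ki; move: sS; rewrite mem_new_faces // (nE kp sD hs) size_anti //; lia.
have [sS|sS] := boolP (s \in new_faces D i); last by case; apply: acyclic_star_face.
have [t tT tmax] := flag_max fl T0.
have T_gt0 : 0 < #|T| by rewrite card_gt0.
(* [q] is the degree in which the star of [val t] in [D] turns out to have homology. *)
set q := k + #|s| + #|T|.-1.
have -> : k + (#|s| + #|T|) = q.+1 by rewrite /q; lia.
rewrite (acyclic_star_flag K cD _ sS FX tT tmax) => nex.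
have le_q : #|val t| <= q by rewrite leqNgt; apply/negP => /acyclic_star_small.
have [j qE] : exists j, q = j + #|val t| by exists (q - #|val t|); rewrite subnK.
have {nex le_q} /(rhomology_link K (val t) j cD) ht :
  ~ acyclic K (star D (val t)) (j + #|val t|).
  by rewrite -qE.
have tD := new_vertexD t.
have jp := le_p tD ht; have ct := nE jp tD ht.
(* Since [val t] is new, its index [j] has [n i.-1 <= n j]; the strict drop at [i] then forces
   [j < i]. *)
have tS : n i.-1 <= n j by rewrite -ct -mem_new_faces //; apply: valP.
have sm : n i.-1 <= #|s| by rewrite -mem_new_faces.
have ji : j < i.
  rewrite ltnNge; apply/negP => ij; have := leq_trans tS (size_anti ij jp).
  by rewrite leqNgt size_gap.
(* As [n j + j = n 0], the degree [q] equals [n 0], so [F] has [n 0 + 1 - k] vertices. The bounds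
   [n i.-1 <= #|s|] and [0 < #|T|] then give [k < i]. *)
have nj := size_low ji; have ni := @size_low i.-1; rewrite prednK // in ni.
have {}ni := ni (leqnn i); rewrite {}ct /q in qE.
have ki : k < i by lia.
by have := size_low ki; rewrite /phi_size ki; split; lia.
Qed.

Lemma phi_link_exists k : k <= p ->
  exists2 F, F \in phi D i & rhomology K (link (phi D i) F) k != 0%VS.
Proof.
move=> kp; have [s sD hs] := ex_face kp; have cs := nE kp sD hs.
have /(rhomology_link K s k cD) nex := hs.
have [ki|ki] := ltnP k i.
  have sS : s \in new_faces D i by rewrite mem_new_faces // cs size_anti; lia.
  (* For [k < i] the witness is [s] together with its own symbol, which accounts for the extra
     vertex. *)
  pose u : new_vertex D i := Sub s sS.
  have us : val u = s by rewrite SubK.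
  exists (face_of s [set u]).
    rewrite mem_phi lpart_face rpart_face sD /=; apply/andP; split.
      by apply/flagP => a b /set1P -> /set1P ->; left.
    by apply/cap_sub => a /set1P ->; rewrite us.
  apply/(rhomology_link K _ k (phi_simplicial cD)).
  by rewrite card_face_of cards1 addn1 addnS -us acyclic_star_single // us.
have sS : s \notin new_faces D i.
  rewrite mem_new_faces // cs -ltnNge; apply: leq_ltn_trans size_gap.
  exact: size_anti.
(* For [k >= i] the face [s] is not new and serves unchanged. *)
exists (face_of s set0).
  rewrite mem_phi lpart_face rpart_face sD /=; apply/andP; split.
    by apply/flagP => a b; rewrite inE.
  by apply/cap_sub => a; rewrite inE.
apply/(rhomology_link K _ k (phi_simplicial cD)).
by rewrite card_face_of cards0 addn0 acyclic_star_old.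
Qed.

End DegreeType.

Theorem theorem6p14 (K : fieldType) (V : finType) (D : {set {set V}})
    (p i : nat) (hi : 1 <= i) (hip : i <= p)
    (ds : seq nat) (di : nat) (hds : size ds = p - i)
    (hPR : PR_complex K D)
    (hdeg : degree_type K D (ds ++ di :: nseq i.-1 1)) :
  PR_complex K (phi D i) /\
  degree_type K (phi D i) (ds ++ di.+1 :: nseq i.-1 1).
Proof.
have [cD _] := hPR.
have sz x : size (ds ++ x :: nseq i.-1 1) = p.
  by rewrite size_cat /= size_nseq hds prednK // subnK.
move: hdeg; rewrite /degree_type !sz => -[le_p [n [nP dP]]].
have nE k s : k <= p -> s \in D -> rhomology K (link D s) k != 0%VS -> #|s| = n k.
  by move=> /nP[_]; apply.
have ex_face k : k <= p -> exists2 s, s \in D & rhomology K (link D s) k != 0%VS.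
  by move=> /nP[].
(* The integer differences are restated additively, which avoids truncated subtraction. *)
have dE j : 1 <= j <= p -> n j.-1 = n j + nth 0 (ds ++ di :: nseq i.-1 1) (p - j).
  by move=> /dP; lia.
have sizeP := phi_link_size hi hip hds cD le_p nE ex_face dE.
split.
  split; first exact: phi_simplicial.
  by move=> k s t sX tX /(sizeP _ _ sX)[_ ->] /(sizeP _ _ tX)[_ ->].
split; first by move=> k s sX /(sizeP _ _ sX)[].
exists (phi_size i n); split=> j jp.
  split; first exact: (phi_link_exists hi hip hds cD nE ex_face dE).
  by move=> s sX /(sizeP _ _ sX)[].
rewrite (nth_cat_cons _ _ di) hds /phi_size.
have dj := dE _ jp; have := dE i; rewrite hi hip => /(_ isT).
rewrite [nth _ _ (p - i)]nth_cat hds ltnn subnn /= => d_i.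
have [ij|ij] := eqVneq (p - j) (p - i).
  have -> : j = i by lia.
  by rewrite ltnn prednK // leqnn; lia.
(* For [j] different from [i], the indices [j - 1] and [j] lie on the same side of [i], so both
   sizes move together. *)
by have -> : (j.-1 < i) = (j < i); [lia | case: ifP; lia].
Qed.
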